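(* Let $\Gamma=(V,E)$ be a connected simple graph of order $n\ge 2$. Then: (i) $\gamma_o(\Gamma)\le \min\left\{n-\alpha(\Gamma),\ \left\lfloor\frac{n+\alpha(\Gamma)}{2}\right\rfloor\right\}$, where $\alpha(\Gamma)$ denotes the independence number of $\Gamma$; (ii) $\gamma_o(\Gamma)\le \left\lfloor\frac{2n}{3}\right\rfloor$; (iii) $\gamma_o(\Gamma)\le \left\lfloor\frac{\gamma(\Gamma)+n}{2}\right\rfloor$, where $\gamma(\Gamma)$ denotes the domination number of $\Gamma$; (iv) $\gamma_o(\Gamma)\le \left\lfloor\frac{n(2\mu-\delta)}{2\mu}\right\rfloor$, where $\mu$ denotes the Laplacian spectral radius of $\Gamma$ and $\delta$ denotes its minimum degree. Here $\gamma_o(\Gamma)$ is the global offensive alliance number of $\Gamma$.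
   Context: Graphs are finite and simple. For $S\subseteq V$ and $v\in V$, $N_S(v)$ is the set of neighbors of $v$ lying in $S$ and $N_{V\setminus S}(v)$ is the set of neighbors of $v$ lying in $V\setminus S$. A non-empty set $S\subseteq V$ (with $S=V$ allowed) is a global offensive alliance in $\Gamma$ if $|N_S(v)|\ge |N_{V\setminus S}(v)|+1$ for every $v\in V\setminus S$. The global offensive alliance number $\gamma_o(\Gamma)$ is the minimum cardinality of a global offensive alliance in $\Gamma$. The Laplacian spectral radius $\mu$ is the largest eigenvalue of the Laplacian matrix (degree matrix minus adjacency matrix) of $\Gamma$. *)

(* Defs.v *)
From mathcomp Require Import all_boot all_order all_algebra.
From mathcomp Require Import all_classical all_reals.

Set Implicit Arguments.
Unset Strict Implicit.
Unset Printing Implicit Defensive.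

Import Order.TTheory GRing.Theory Num.Theory.

(* A simple graph on the vertex set V is given by its adjacency relation      *)
(* e : rel V, assumed symmetric and irreflexive.                              *)

Section Graph.
Variables (V : finType) (e : rel V).

Definition simple_graph : Prop := symmetric e /\ irreflexive e.

Definition connected_graph : Prop := forall x y : V, connect e x y.

Definition neighbors (v : V) : {set V} := [set u | e v u].

Definition degree (v : V) : nat := #|neighbors v|.

(* All the cardinalities minimized below are at most #|V|, so the default     *)
(* value #|V| of the iterated minima is neutral.                              *)
Definition min_degree : nat := \big[minn/#|V|]_(v : V) degree v.

Definition independent (S : {set V}) : bool :=
  [forall u in S, forall v in S, ~~ e u v].

Definition independence_number : nat :=
  \max_(S : {set V} | independent S) #|S|.

Definition dominating (S : {set V}) : bool :=
  [forall v in ~: S, exists u in S, e v u].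

Definition domination_number : nat :=
  \big[minn/#|V|]_(S : {set V} | dominating S) #|S|.

Definition global_offensive_alliance (S : {set V}) : bool :=
  (S != finset.set0) &&
  [forall v in ~: S,
     #|neighbors v :&: ~: S| + 1 <= #|neighbors v :&: S|].

Definition global_offensive_alliance_number : nat :=
  \big[minn/#|V|]_(S : {set V} | global_offensive_alliance S) #|S|.

End Graph.

Section Laplacian.
Local Open Scope ring_scope.
Variables (R : realType) (V : finType) (e : rel V).

(* Rows and columns are indexed by the enumeration of V.                      *)
Definition degree_mx : 'M[R]_#|V| :=
  diag_mx (\row_i (degree e (enum_val i))%:R).

Definition adjacency_mx : 'M[R]_#|V| :=
  \matrix_(i, j) (e (enum_val i) (enum_val j))%:R.

Definition laplacian_mx : 'M[R]_#|V| := degree_mx - adjacency_mx.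

(* The supremum is attained as soon as V is nonempty: see                     *)
(* laplacian_spectral_radiusP below.                                          *)
Definition laplacian_spectral_radius : R :=
  sup [set a : R | eigenvalue laplacian_mx a]%classic.

Lemma eigenvalue0_laplacian : (0 < #|V|)%N -> symmetric e ->
  eigenvalue laplacian_mx 0.
Proof.
move=> V0 esym; apply/eigenvalueP; exists (const_mx 1); last first.
  apply/eqP => /rowP /(_ (Ordinal V0)); rewrite !mxE => /eqP.
  by rewrite oner_eq0.
rewrite scale0r; apply/rowP => j; rewrite mulmxBr !mxE.
apply/eqP; rewrite subr_eq0; apply/eqP.
rewrite (bigD1 j) //= !mxE eqxx mulr1n mul1r big1 ?addr0; last first.
  by move=> i /negPf ij; rewrite !mxE ij mulr0n mulr0.
under eq_bigr do rewrite !mxE mul1r.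
rewrite -natr_sum; congr (_ %:R).
rewrite /degree -sum1_card big_mkcond /=.
rewrite (reindex (@enum_val V predT)) /=; last first.
  by apply: onW_bij; exact: enum_val_bij.
by apply: eq_bigr => i _; rewrite inE esym; case: (e _ _).
Qed.

Lemma laplacian_spectral_radiusP : (0 < #|V|)%N -> symmetric e ->
  eigenvalue laplacian_mx laplacian_spectral_radius /\
  forall a : R, eigenvalue laplacian_mx a -> a <= laplacian_spectral_radius.
Proof.
move=> V0 esym; pose E a := eigenvalue laplacian_mx a.
have bnd (s : seq R) : uniq s -> all E s -> (size s <= #|V|)%N.
  move=> us Es.
  have p0 : char_poly laplacian_mx != 0 by exact/monic_neq0/char_poly_monic.
  have := max_poly_roots p0 _ us; rewrite size_char_poly ltnS; apply.
  by apply: sub_all Es => x; rewrite -eigenvalue_root_char.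
suff [m [Em mM]] : exists m, E m /\ forall a, E a -> a <= m.
  have -> : laplacian_spectral_radius = m; last by [].
  apply/eqP; rewrite eq_le; apply/andP; split.
    by apply: ge_sup; [exists m | move=> a /mM].
  by apply: ub_le_sup => //; exists m => a /mM.
apply: contrapT => noM.
have up a : E a -> exists b, E b /\ a < b.
  move=> Ea; apply: contrapT => h; apply: noM; exists a; split=> // b Eb.
  by rewrite leNgt; apply/negP => ab; apply: h; exists b.
suff [s [a [ss Es Ea ha]]] : exists s a,
    [/\ size s = #|V|, uniq s && all E s, E a & forall x, x \in s -> x < a].
  move: Es => /andP[us Es]; have as_ : a \notin s.
    by apply/negP => /ha; rewrite ltxx.
  have := bnd (a :: s); rewrite /= as_ us Ea Es ss ltnn.
  by move=> /(_ isT isT).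
elim: #|V| => [|k [s [a [ss /andP[us Es] Ea ha]]]].
  by exists [::], 0; split => //; exact: eigenvalue0_laplacian.
have [b [Eb ab]] := up a Ea; exists (a :: s), b; split => //=.
- by rewrite ss.
- by rewrite us Es Ea !andbT; apply/negP => /ha; rewrite ltxx.
- move=> x; rewrite inE => /orP[/eqP->//|/ha xa]; exact: lt_trans ab.
Qed.

End Laplacian.

(* Main.v *)
Require Import Defs.
From mathcomp Require Import all_boot all_order all_algebra.
From mathcomp Require Import all_classical all_reals.
From mathcomp Require Import fintype finset spectral sesquilinear complex.
From mathcomp Require Import zify lra ring.

(* The complement of a maximum independent set is a global offensive          *)
(* alliance, since every vertex has a neighbor. Given a dominating set D,     *)
(* split V \ D along a maximum cut of the graph induced on it: every vertex   *)
(* has at least as many neighbors across the cut as on its own side, and one  *)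
(* more neighbor in D, so D together with either side is a global offensive   *)
(* alliance; the smaller side gives (iii). Maximal independent sets dominate, *)
(* so gamma <= alpha and (iii) gives the second half of (i); (ii) follows     *)
(* from (i) by comparing alpha with n / 3. Finally (iv) is (n + alpha) / 2    *)
(* combined with the Hoffman-type bound alpha <= n (mu - delta) / mu, i.e.    *)
(* the Rayleigh quotient of the Laplacian at a combination of the indicator   *)
(* of a maximum independent set and the all-ones vector.                      *)

Set Implicit Arguments.
Unset Strict Implicit.
Unset Printing Implicit Defensive.

Import Order.TTheory GRing.Theory Num.Theory.

(** Three facts carry everything. [gamma_o_le_independent] and [gamma_o_le_dominating] turn an
    independent and a dominating set into alliances, and [domination_le_independence] links the two,
    so that [gamma_o] is at most both [n - alpha] and [(n + alpha) / 2]. The spectral bound replaces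
    [alpha] by the estimate of [independent_degree_le], which rests on [rayleigh_le]. *)

Lemma geq_bigmin (I : finType) (P : pred I) (F : I -> nat) (m : nat) (i : I) :
  P i -> \big[minn/m]_(j | P j) F j <= F i.
Proof.
move=> Pi; have := mem_index_enum i.
elim: (index_enum I) => //= j s IHs; rewrite inE big_cons.
case: eqVneq => [<- _|_ /= /IHs le_i]; first by rewrite Pi geq_minl.
by case: ifP => // _; exact: leq_trans (geq_minr _ _) le_i.
Qed.

(** An operation that returns one of its arguments never leaves the default and the listed values. A
    bound proved for every set thus passes to the extremum without choosing an optimal set. *)
Lemma big_prop_extremum (I : finType) (P : pred I) (F : I -> nat) (m : nat)
    (op : nat -> nat -> nat) (Q : nat -> Prop) :
    (forall a b, op a b = a \/ op a b = b) ->
  Q m -> (forall i, P i -> Q (F i)) -> Q (\big[op/m]_(i | P i) F i).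
Proof.
move=> opP Qm QF; elim/big_ind: _ => // a b Qa Qb.
by case: (opP a b) => ->.
Qed.

(** * Maximum cuts *)

Section Alliance.
Variables (V : finType) (e : rel V).

(** Ordered pairs are counted, so each edge contributes twice. *)
Let monochromatic (A : {set V}) :=
  \sum_u \sum_w (e u w && ((u \in A) == (w \in A)) : nat).

(* Minimize the number of monochromatic edges: moving v across the cut        *)
(* exchanges its monochromatic and its cut edges and affects no other edge.   *)
Lemma max_cut : simple_graph e -> exists A : {set V}, forall v,
  #|[set w | e v w && ((w \in A) == (v \in A))]| <=
  #|[set w | e v w && ((w \in A) != (v \in A))]|.
Proof.
move=> [esym eirr].
pose A := [arg min_(B < [set: V] | true) monochromatic B]%N.
have Amin B : monochromatic A <= monochromatic B.
  by rewrite /A; case: arg_minnP => // C _; apply.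
exists A => v; pose B := [set u | (u \in A) (+) (u == v)].
(* The first summand ignores the side of [v]; the second holds both orientations of the edges at
   [v]. *)
have split_at C : monochromatic C =
    \sum_(u | u != v) \sum_(w | w != v) (e u w && ((u \in C) == (w \in C)))
    + 2 * #|[set w | e v w && ((w \in C) == (v \in C))]|.
  rewrite /monochromatic (bigD1 v) //= addnC.
  under eq_bigr do rewrite (bigD1 v) //=.
  rewrite big_split /= addnAC addnC; congr addn.
  have -> : \sum_(u | u != v) (e u v && ((u \in C) == (v \in C)))
          = \sum_u (e v u && ((u \in C) == (v \in C)) : nat).
    rewrite [RHS](bigD1 v) //= eirr add0n.
    by apply: eq_bigr => u _; rewrite esym.
  have -> : \sum_w (e v w && ((v \in C) == (w \in C)) : nat)
          = \sum_u (e v u && ((u \in C) == (v \in C)) : nat).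
    by apply: eq_bigr => u _; rewrite (eq_sym (v \in C)).
  rewrite addnn -mul2n; congr (2 * _).
  rewrite -sum1dep_card [RHS]big_mkcond /=.
  by apply: eq_bigr => u _; case: (_ && _).
have := Amin B; rewrite !split_at.
have -> : [set w | e v w && ((w \in B) == (v \in B))]
        = [set w | e v w && ((w \in A) != (v \in A))].
  apply/setP => w; rewrite !inE eqxx.
  case: (eqVneq w v) => [->|_]; first by rewrite eirr.
  by case: (w \in A); case: (v \in A).
have -> : \sum_(u | u != v) \sum_(w | w != v)
             (e u w && ((u \in B) == (w \in B)))
        = \sum_(u | u != v) \sum_(w | w != v)
             (e u w && ((u \in A) == (w \in A))).
  apply: eq_bigr => u /negPf uv; apply: eq_bigr => w /negPf wv.
  by rewrite !inE uv wv !addbF.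
by rewrite leq_add2l leq_mul2l.
Qed.

End Alliance.

(** * Combinatorial bounds *)

Section Bounds.
Variables (V : finType) (e : rel V).
Hypotheses (esimple : simple_graph e) (econn : connected_graph e)
  (cardV : 2 <= #|V|).

Lemma degree_gt0 v : 0 < degree e v.
Proof.
have [w wv] : exists w, w != v.
  apply/existsP; rewrite -negb_forall; apply: contraL cardV => /forallP h.
  rewrite -ltnNge ltnS -(card1 v) subset_leq_card //.
  by apply/subsetP => x _; rewrite inE; exact: h.
have /connectP[[|u p] /= pth lastp] := econn v w.
  by rewrite lastp eqxx in wv.
by apply/card_gt0P; exists u; rewrite inE; case/andP: pth.
Qed.

Lemma gamma_o_le (S : {set V}) : global_offensive_alliance e S ->
  global_offensive_alliance_number e <= #|S|.
Proof. exact: geq_bigmin. Qed.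

Lemma gamma_o_le_order : global_offensive_alliance_number e <= #|V|.
Proof.
rewrite -cardsT; apply: gamma_o_le; apply/andP; split.
  by rewrite -card_gt0 cardsT ltnW.
by apply/forallP => v; rewrite !inE.
Qed.

Lemma gamma_o_le_independent (S : {set V}) : independent e S ->
  global_offensive_alliance_number e <= #|V| - #|S|.
Proof.
move=> indS; have -> : #|V| - #|S| = #|~: S| by rewrite [RHS]cardsCs setCK.
apply: gamma_o_le.
have nbrs v : v \in S -> neighbors e v \subset ~: S.
  move=> vS; apply/subsetP => w; rewrite !inE; apply: contraTN => wS.
  by move/forall_inP/(_ v vS)/forall_inP/(_ w wS): indS.
have /card_gt0P[v _] : 0 < #|V| by exact: ltnW.
apply/andP; split; last first.
  apply/forall_inP => w; rewrite !setCK => /nbrs nw.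
  rewrite (setIidPl nw).
  have -> : neighbors e w :&: S = set0.
    by apply/disjoint_setI0; rewrite disjoints_subset.
  by rewrite cards0; exact: degree_gt0.
have [vS|vS] := boolP (v \in S); last by apply/set0Pn; exists v; rewrite inE.
have /card_gt0P[w wv] := degree_gt0 v.
by apply/set0Pn; exists w; exact: (subsetP (nbrs v vS)).
Qed.

Lemma gamma_o_le_dominating (D : {set V}) : dominating e D ->
  global_offensive_alliance_number e <= (#|D| + #|V|) %/ 2.
Proof.
move=> domD; case: esimple => esym eirr.
have Dn0 : D != set0.
  have /card_gt0P[v _] : 0 < #|V| by exact: ltnW.
  apply/negP => /eqP D0; move/forall_inP: domD => /(_ v).
  by rewrite D0 !inE => /(_ isT) /exists_inP[u]; rewrite inE.
(* Deleting every edge that meets [D] makes a cut of [g] a cut of the graph induced on the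
   complement of [D]. *)
pose g := [rel u w | [&& u \notin D, w \notin D & e u w]].
have gsimple : simple_graph g.
  by split=> [u w|u] /=; rewrite ?eirr ?andbF // esym andbCA.
have [A cutA] := max_cut gsimple.
(* The condition says that [C] cuts the complement of [D] as [A] does; it is used for [A] and for
   its complement. *)
have alliance (C : {set V}) :
    (forall w v, w \notin D -> v \notin D ->
       (w \in C) == (v \in C) = ((w \in A) == (v \in A))) ->
    global_offensive_alliance e (D :|: C).
  move=> CA; apply/andP; split.
    by apply: contraNneq Dn0 => /eqP; rewrite setU_eq0 => /andP[].
  apply/forall_inP => v; rewrite !inE negb_or => /andP[vD vC].
  have [u uD evu] : exists2 u, u \in D & e v u.
    by move/forall_inP: domD => /(_ v); rewrite inE => /(_ vD) /exists_inP.
  have := cutA v; set X := [set w | _]; set Y := [set w | _] => le_XY.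
  have -> : neighbors e v :&: ~: (D :|: C) = X.
    apply/setP => w; rewrite !inE negb_or /= vD /=.
    case: (boolP (w \in D)) => [|wD]; first by rewrite andbF.
    by rewrite /= -CA // (negPf vC); case: (w \in C).
  rewrite addn1; apply: leq_ltn_trans le_XY _; apply: proper_card.
  apply/properP; split.
    apply/subsetP => w; rewrite !inE /= => /andP[/and3P[_ wD ->]] /=.
    by rewrite -CA // (negPf vC) (negPf wD); case: (w \in C).
  (* The dominating neighbor [u] is not counted by [Y]; this strictness is the required excess of
     one. *)
  by exists u; rewrite !inE ?evu ?uD //= uD /= andbF.
have boundC (C : {set V}) : global_offensive_alliance e (D :|: C) ->
    global_offensive_alliance_number e <= #|D| + #|C :\: D|.
  move=> /gamma_o_le /leq_trans; apply.
  have -> : D :|: C = D :|: C :\: D.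
    by apply/setP => w; rewrite !inE; case: (w \in D).
  exact: leq_card_setU.
have := boundC A (alliance A (fun _ _ _ _ => erefl)).
have /boundC : global_offensive_alliance e (D :|: ~: A).
  by apply: alliance => w v _ _; rewrite !inE; case: (w \in A); case: (v \in A).
have : #|A :\: D| + #|~: A :\: D| = #|V| - #|D|.
  rewrite -[#|V|](cardsC D) addKn -(cardsID A (~: D)).
  by congr (_ + _); apply: eq_card => w; rewrite !inE // andbC.
have : #|D| <= #|V| by exact: max_card.
move: (global_offensive_alliance_number e) #|D| #|V| #|A :\: D| #|~: A :\: D|.
lia.
Qed.

Lemma gamma_o_le_order_independence :
  global_offensive_alliance_number e <= #|V| - independence_number e.
Proof.
apply: (big_prop_extremum (Q := fun k => _ <= #|V| - k)) => [a b||].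
- by rewrite /maxn; case: ifP; [right|left].
- by rewrite subn0 gamma_o_le_order.
- exact: gamma_o_le_independent.
Qed.

Lemma gamma_o_le_domination :
  global_offensive_alliance_number e <= (domination_number e + #|V|) %/ 2.
Proof.
apply: (big_prop_extremum (Q := fun k => _ <= (k + #|V|) %/ 2)) => [a b||].
- by rewrite /minn; case: ifP; [left|right].
(* The default value [#|V|] yields the trivial bound by the order. *)
- by rewrite addnn -mul2n mulKn // gamma_o_le_order.
- exact: gamma_o_le_dominating.
Qed.

Lemma maximum_independent :
  exists2 S : {set V}, independent e S & #|S| = independence_number e.
Proof.
have ind0 : independent e set0 by apply/forall_inP => v; rewrite inE.
have := @eq_bigmax_cond _ (independent e) (fun S : {set V} => #|S|).
case; first by apply/card_gt0P; exists set0.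
by move=> S indS max_S; exists S => //; rewrite -max_S.
Qed.

Lemma domination_le_independence : domination_number e <= independence_number e.
Proof.
have [S indS cardS] := maximum_independent; rewrite -cardS.
apply: geq_bigmin; apply/forall_inP => v; rewrite inE => vS.
apply: contraT => nodom; case: esimple => esym eirr.
have nodomv u : u \in S -> ~~ e v u.
  by move=> uS; apply: contra nodom => evu; apply/exists_inP; exists u.
suff indvS : independent e (v |: S).
  have : #|v |: S| <= independence_number e by exact: leq_bigmax_cond.
  by rewrite -cardS cardsU1 vS ltnn.
apply/forall_inP => u; rewrite !inE => /predU1P[->|uS];
  apply/forall_inP => w; rewrite !inE => /predU1P[->|wS].
- by rewrite eirr.
- exact: nodomv.
- by rewrite esym nodomv.
- by move/forall_inP/(_ u uS)/forall_inP/(_ w wS): indS.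
Qed.

Lemma independence_gt0 : 0 < independence_number e.
Proof.
have /card_gt0P[v _] : 0 < #|V| by exact: ltnW.
rewrite -(cards1 v); apply: (@leq_bigmax_cond _ _ (fun S : {set V} => #|S|)).
case: esimple => _ eirr.
by do 2!apply/forall_inP => ? /set1P ->; rewrite eirr.
Qed.

Lemma min_degree_gt0 : 0 < min_degree e.
Proof.
apply: (big_prop_extremum (Q := fun k => 0 < k)) => [a b||v _].
- by rewrite /minn; case: ifP; [left|right].
- exact: ltnW.
- exact: degree_gt0.
Qed.

End Bounds.

(** * Rayleigh quotients *)

Section RealBounds.
Local Open Scope ring_scope.
Local Open Scope sesquilinear_scope.

(** Over the complex extension the symmetric matrix is hermitian, hence diagonalized by a unitary
    [P]. In the coordinates [y] the inequality holds term by term. *)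
Lemma rayleigh_le (R : rcfType) (n : nat) (A : 'M[R]_n) (m : R) (x : 'rV_n) :
    A^T = A -> (forall a, eigenvalue A a -> a <= m) ->
  (x *m A *m x^T) 0 0 <= m * (x *m x^T) 0 0.
Proof.
move=> symA eigA; pose c := real_complex R.
pose B := map_mx c A; pose z := map_mx c x.
have conjc_real p q (M : 'M[R]_(p, q)) : (map_mx c M)^t* = map_mx c M^T.
  by apply/matrixP => i j; rewrite !mxE; apply/CrealP/complex_realP;
     exists (M j i).
have hermB : B \is hermsymmx.
  by apply/is_hermitianmxP; rewrite scale1r conjc_real symA.
set P := spectralmx B; set D := spectral_diag B.
have BE : B = P^t* *m diag_mx D *m P.
  rewrite -invmx_unitary ?spectral_unitarymx //.
  by apply/orthomx_spectralP; exact: hermitian_normalmx.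
have PPt : P *m P^t* = 1%:M by apply/unitarymxP; exact: spectral_unitarymx.
have PtP : P^t* *m P = 1%:M by exact: mulmx1C.
pose y := z *m P^t*.
have yt : y^t* = P *m z^t*.
  by rewrite trmx_mul map_mxM; congr (_ *m _); exact: trmxCK.
have Deig i : D 0 i \is Num.real -> eigenvalue A (complex.Re (D 0 i)).
  move=> Dreal; rewrite -(eigenvalue_map c) /= -/B RRe_real //.
  apply/eigenvalueP; exists (row i P).
    by rewrite BE !mulmxA -row_mul PPt row1 -rowE row_diag_mx -scalemxAl -rowE.
  (* A row of a unitary matrix has norm one, so it is not zero. *)
  apply: contraTneq (oner_neq0 (complex R)) => Pi0.
  have PPii : (P *m P^t*) i i = 1 by rewrite PPt mxE eqxx.
  rewrite negbK -PPii mxE big1 // => j _; have /rowP/(_ j) := Pi0.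
  by rewrite !mxE => ->; rewrite mul0r.
have Dle i : D 0 i <= c m.
  have Dreal : D 0 i \is Num.real.
    by have /mxOverP := hermitian_spectral_diag_real hermB; exact.
  by rewrite -(RRe_real Dreal) lecR; exact/eigA/Deig.
suff: c ((x *m A *m x^T) 0 0) <= c m * c ((x *m x^T) 0 0).
  by rewrite -rmorphM lecR.
have cE p q (M : 'M[R]_(p, q)) i j : c (M i j) = map_mx c M i j by rewrite mxE.
have zt : map_mx c x^T = z^t* by rewrite conjc_real.
rewrite !cE !map_mxM /= -/B -/z zt.
have -> : z *m B *m z^t* = y *m diag_mx D *m y^t* by rewrite yt BE !mulmxA.
have -> : z *m z^t* = y *m y^t*.
  by rewrite yt mulmxA -(mulmxA z) PtP mulmx1.
rewrite !mxE mulr_sumr ler_sum // => i _.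
rewrite mul_mx_diag !mxE mulrAC mulrC ler_wpM2r //.
exact: mul_conjC_ge0.
Qed.

(** Here [x], [d], [a], [y], [m] stand for [n], [delta], [alpha], [gamma_o], [mu]. The last
    hypothesis is the Hoffman-type bound without division; it also forces [m] to be positive. *)
Lemma floor_argument_bound (R : realFieldType) (x d a y m : R) :
    a <= x -> 0 < d -> 0 < x -> y * 2 <= x + a -> d * x <= m * (x - a) ->
  y <= x * (2 * m - d) / (2 * m).
Proof.
move=> ax d0 x0 yxa dm; have dx : 0 < d * x by rewrite mulr_gt0.
have m0 : 0 < m by rewrite ltNge; apply/negP => m0; nra.
by rewrite ler_pdivlMr ?mulr_gt0 //; nra.
Qed.

End RealBounds.

(** * The Laplacian and independent sets *)

Section LaplacianBound.
Local Open Scope ring_scope.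
Variables (R : realType) (V : finType) (e : rel V).
Hypothesis esimple : simple_graph e.

Lemma sum_enum_val (F : V -> R) : \sum_(i < #|V|) F (enum_val i) = \sum_v F v.
Proof.
rewrite [RHS](reindex (@enum_val V predT)) //=.
by apply: onW_bij; exact: enum_val_bij.
Qed.

Definition edge (u w : V) : R := (e u w)%:R.

Lemma edge_sum (u : V) : \sum_w edge u w = (degree e u)%:R.
Proof.
rewrite /degree -sum1_card natr_sum [RHS]big_mkcond /=.
by apply: eq_bigr => w _; rewrite inE /edge; case: (e u w).
Qed.

(** Symmetrizing in [u] and [w] would give the usual sum of squared differences over the edges. *)
Lemma laplacian_form (f : V -> R) (x : 'rV_#|V| := \row_i f (enum_val i)) :
  (x *m laplacian_mx R e *m x^T) 0 0 =
  \sum_u \sum_w edge u w * (f u * (f u - f w)).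
Proof.
case: esimple => esym _.
rewrite mulmxBr mulmxBl mxE [X in _ + X]mxE !mxE.
rewrite mul_mx_diag.
have -> : \sum_j (\matrix_(i, j)
        (x i j * (\row_k (degree e (enum_val k))%:R) 0 j)) 0 j * x^T j 0
    = \sum_u \sum_w edge u w * (f u * f u).
  rewrite -sum_enum_val; apply: eq_bigr => i _.
  by rewrite !mxE -mulr_suml edge_sum; ring.
have -> : \sum_j ((x *m adjacency_mx R e) 0 j * x^T j 0)
    = \sum_u \sum_w edge u w * (f u * f w).
  rewrite -sum_enum_val; apply: eq_bigr => i _.
  rewrite !mxE mulr_suml -[RHS]sum_enum_val; apply: eq_bigr => j _.
  by rewrite !mxE /edge esym; ring.
rewrite -sumrB; apply: eq_bigr => u _; rewrite -sumrB; apply: eq_bigr => w _.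
by ring.
Qed.

Lemma independent_degree_le (S : {set V}) : independent e S -> (0 < #|S|)%N ->
  (min_degree e)%:R * #|V|%:R <=
  laplacian_spectral_radius R e * (#|V| - #|S|)%:R.
Proof.
move=> indS S0; case: (esimple) => esym eirr.
have V0 : (0 < #|V|)%N by exact: leq_trans S0 (max_card _).
set mu := laplacian_spectral_radius R e.
pose n : R := #|V|%:R; pose s : R := #|S|%:R.
(* The test vector n 1_S - |S| is orthogonal to the constants; with the       *)
(* indicator of S alone the Rayleigh bound would not involve |S|.             *)
pose h (v : V) : R := (v \in S)%:R; pose f v := n * h v - s.
pose x : 'rV_#|V| := \row_i f (enum_val i).
have hh v : h v * h v = h v by rewrite /h -natrM mulnb andbb.
have sumh : \sum_v h v = s.
  rewrite /s -sum1_card natr_sum [RHS]big_mkcond /=.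
  by apply: eq_bigr => v _; rewrite /h; case: (v \in S).
have symL : (laplacian_mx R e)^T = laplacian_mx R e.
  apply/matrixP => i j; rewrite !mxE esym; congr (_ - _).
  by case: (eqVneq i j) => [->|/negPf]; rewrite ?eqxx // eq_sym => ->.
have xLx : (x *m laplacian_mx R e *m x^T) 0 0
    = n ^+ 2 * \sum_u h u * (degree e u)%:R.
  rewrite laplacian_form.
  (* Independence kills the product [h u * h w] on edges; what remains besides the main term is
     antisymmetric and cancels in the double sum. *)
  have term u w : edge u w * (f u * (f u - f w)) =
      n ^+ 2 * (h u * edge u w) - n * s * (edge u w * h u - edge w u * h w).
    have : edge u w * (h u * h w) = 0.
      rewrite /edge /h; case: (boolP (u \in S)) => uS;
        last by rewrite mul0r mulr0.
      case: (boolP (w \in S)) => wS; last by rewrite !mulr0.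
      move/forall_inP/(_ u uS)/forall_inP/(_ w wS)/negPf: indS => ->.
      by rewrite mul0r.
    rewrite [edge w u]/edge esym -/(edge u w) /f; move: (hh u).
    move: (h u) (h w) (edge u w) => a b c aa ab.
    have -> : c * ((n * a - s) * (n * a - s - (n * b - s))) =
       n ^+ 2 * (c * (a * a)) - n ^+ 2 * (c * (a * b))
       - n * s * (c * a - c * b) by ring.
    by rewrite aa ab; ring.
  under eq_bigr do under eq_bigr do rewrite term.
  under eq_bigr do rewrite sumrB -!mulr_sumr sumrB.
  rewrite sumrB -!mulr_sumr sumrB.
  rewrite [X in _ - _ * (_ - X)]exchange_big subrr mulr0 subr0.
  by congr (_ * _); apply: eq_bigr => u _; rewrite edge_sum.
have xx : (x *m x^T) 0 0 = n * s * (n - s).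
  rewrite mxE; under eq_bigr do rewrite !mxE.
  rewrite (sum_enum_val (fun v => f v * f v)).
  have term v : f v * f v = (n ^+ 2 - 2 * n * s) * h v + s ^+ 2.
    have -> : f v * f v = n ^+ 2 * (h v * h v) - 2 * n * s * h v + s ^+ 2.
      by rewrite /f; ring.
    by rewrite hh; ring.
  under eq_bigr do rewrite term.
  rewrite big_split /= -mulr_sumr sumh sumr_const -mulr_natr -/n; ring.
have degS : (min_degree e)%:R * s <= \sum_u h u * (degree e u)%:R.
  rewrite -sumh mulr_sumr ler_sum // => u _; rewrite mulrC ler_wpM2l ?ler0n //.
  by rewrite ler_nat; exact: geq_bigmin.
have := rayleigh_le x symL (laplacian_spectral_radiusP R V0 esym).2.
rewrite xLx xx -/mu natrB ?max_card // -/n -/s => rayleigh.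
have n0 : 0 < n by rewrite ltr0n.
have s0 : 0 < s by rewrite ltr0n.
have ns0 : 0 < n * s by rewrite mulr_gt0.
rewrite -(ler_pM2l ns0).
have -> : n * s * (mu * (n - s)) = mu * (n * s * (n - s)) by ring.
apply: le_trans rayleigh.
have -> : n * s * ((min_degree e)%:R * n)
    = n ^+ 2 * ((min_degree e)%:R * s) by ring.
by rewrite ler_wpM2l // exprn_ge0 // ltW.
Qed.

End LaplacianBound.

Theorem theorem1 (R : realType) (V : finType) (e : rel V)
    (hsimple : simple_graph e) (hconn : connected_graph e)
    (hn : (2 <= #|V|)%N) :
  let n := #|V| in
  let gamma_o := global_offensive_alliance_number e in
  let alpha := independence_number e in
  let gamma := domination_number e in
  let delta := min_degree e in
  let mu := laplacian_spectral_radius R e in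
  [/\ (gamma_o <= minn (n - alpha) ((n + alpha) %/ 2))%N,
      (gamma_o <= (2 * n) %/ 3)%N,
      (gamma_o <= (gamma + n) %/ 2)%N &
      (gamma_o%:Z <=
         Num.floor (n%:R * (2%:R * mu - delta%:R) / (2%:R * mu)))%R].
Proof.
move=> n gamma_o alpha gamma delta mu.
have le_dom : gamma_o <= (gamma + n) %/ 2 := gamma_o_le_domination hsimple hn.
have le_ind : gamma_o <= n - alpha := gamma_o_le_order_independence hconn hn.
have gamma_alpha : gamma <= alpha := domination_le_independence hsimple.
have [S indS cardS] := maximum_independent e.
have alpha_n : alpha <= n by rewrite /alpha -cardS max_card.
have alpha_gt0 : 0 < alpha := independence_gt0 hsimple hn.
have delta_gt0 : 0 < delta := min_degree_gt0 hconn hn.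
(* For (ii), adding [gamma_o <= n - alpha] and [2 * gamma_o <= n + alpha] eliminates [alpha]. *)
split=> //; [by rewrite leq_min le_ind /=; lia | lia |].
have := independent_degree_le R hsimple indS.
rewrite cardS -/alpha -/mu -/delta -/n.
move=> /(_ alpha_gt0).
have : gamma_o * 2 <= n + alpha by lia.
rewrite floor_ge_int natrB // -(ler_nat R) natrM natrD.
have : (0 < n%:R :> R)%R by rewrite ltr0n; lia.
have : (0 < delta%:R :> R)%R by rewrite ltr0n.
have : (alpha%:R <= n%:R :> R)%R by rewrite ler_nat.
exact: floor_argument_bound.
Qed.
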